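(* Let $c,d\in\mathbb R^2$, let $0<\rho<\rho'$ and $0<\tau<\tau'$ be real numbers, and let $S=S(c,\rho)\cup S(c,\rho')$ and $R=S(d,\tau)\cup S(d,\tau')$. Then the sets $S$ and $R$ are betweenness isomorphic if and only if $\dfrac{\rho}{\rho'}=\dfrac{\tau}{\tau'}$.
   Context: For $c\in\mathbb R^2$ and $\rho\in(0,\infty)$, $S(c,\rho)$ denotes the circle (curve, not disc) in the Euclidean plane with center $c$ and radius $\rho$. For $u,v\in\mathbb R^2$, $[u,v]=\{\lambda u+(1-\lambda)v:\lambda\in[0,1]\}$. For $A,B\subseteq\mathbb R^2$, a betweenness isomorphism from $A$ to $B$ is a bijection $f\colon A\to B$ such that for all $x,y,z\in A$: $f(x)\in[f(y),f(z)]$ if and only if $x\in[y,z]$. The sets $A,B$ are betweenness isomorphic if such an $f$ exists. *)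

(* Defs.v *)
From mathcomp Require Import all_boot all_order all_algebra.
From mathcomp Require Import all_classical all_reals.
Set Implicit Arguments.
Unset Strict Implicit.
Unset Printing Implicit Defensive.
Import Order.TTheory GRing.Theory Num.Theory.
Local Open Scope classical_set_scope.
Local Open Scope ring_scope.

(* The norm `|u| that MathComp-Analysis puts on 'rV[R]_2 is the sup norm. *)
Definition euclid_norm (R : realType) (u : 'rV[R]_2) : R :=
  Num.sqrt (\sum_(i < 2) u 0 i ^+ 2).

Definition circle (R : realType) (c : 'rV[R]_2) (rho : R) : set 'rV[R]_2 :=
  [set x | euclid_norm (x - c) = rho].

Definition segment (R : realType) (u v : 'rV[R]_2) : set 'rV[R]_2 :=
  [set l *: u + (1 - l) *: v | l in [set l : R | 0 <= l <= 1]].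

(* Only the restriction of f to A matters: set_bij A B f says that f maps A
   bijectively onto B, and f is otherwise arbitrary outside A. *)
Definition betweenness_isomorphism (R : realType) (A B : set 'rV[R]_2)
    (f : 'rV[R]_2 -> 'rV[R]_2) : Prop :=
  set_bij A B f /\
  forall x y z, A x -> A y -> A z ->
    (segment (f y) (f z) (f x) <-> segment y z x).

Definition betweenness_isomorphic (R : realType) (A B : set 'rV[R]_2) : Prop :=
  exists f : 'rV[R]_2 -> 'rV[R]_2, betweenness_isomorphism A B f.

(* Main.v *)
Require Import Defs.
From mathcomp Require Import all_boot all_order all_algebra.
From mathcomp Require Import all_classical all_reals trigo.
From mathcomp Require Import ring lra.
Set Implicit Arguments.
Unset Strict Implicit.
Unset Printing Implicit Defensive.
Import Order.TTheory GRing.Theory Num.Theory.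
Local Open Scope classical_set_scope.
Local Open Scope ring_scope.

(** The converse implication is realised by a homothety. For the direct one,
    the outer circle consists of the points that lie strictly between no two
    others, so an isomorphism matches outer with outer and inner with inner
    points. It therefore preserves, for two outer points, whether the chord
    misses the inner circle and whether it meets it in exactly one point, that
    is, whether their angular distance is less than, or equal to, the angle
    alpha with cos alpha = 2 (rho / rho')^2 - 1 subtended by a tangent chord.

    Follow tangent chords without turning back ([tangent_walk]): the k-th
    point is the rotation of the starting point by k alpha, in one of the two
    directions. The image is again such a walk, with angle beta for the second
    pair of circles. So, for every k, the angle k alpha is closer than alpha
    to a multiple of 2 pi exactly when k beta is closer than beta to one, and
    k alpha is a multiple of 2 pi exactly when k beta is ([walk_avoids],
    [walk_returns]).

    This pattern of returns determines the angle. Each time the sequence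
    k alpha passes a multiple of 2 pi, it has one term within alpha before it
    and one within alpha after it, an exact hit playing both parts. Counting an
    exact hit twice, the number of near returns up to time n is thus
    n alpha / pi up to a bounded error ([sum_return_weight],
    [wrap_count_approx]). The same counts for beta force alpha = beta, hence
    the equality of the ratios. *)

(** * Rotation angles and their near returns *)

(** Angles are measured in full turns, so that integers play the role of the
    multiples of 2 pi. *)
Definition turn_cos (R : realType) (x : R) : R := cos (x * (pi *+ 2)).

Lemma turn_cos0 (R : realType) : turn_cos (0 : R) = 1.
Proof. by rewrite /turn_cos mul0r cos0. Qed.

Lemma turn_cosN (R : realType) (x : R) : turn_cos (- x) = turn_cos x.
Proof. by rewrite /turn_cos mulNr cosN. Qed.

Lemma turn_cosDz (R : realType) (x : R) (m : int) :
  turn_cos (x + m%:~R) = turn_cos x.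
Proof.
have nat_case (y : R) (n : nat) : turn_cos (y + n%:R) = turn_cos y.
  by rewrite /turn_cos mulrDl mulr_natl (periodicn (@cosD2pi R)).
case: m => k; first exact: nat_case.
by rewrite NegzE mulrNz -[in RHS](subrK k.+1%:R x) nat_case.
Qed.

Lemma turn_cos_decr (R : realType) (x y : R) :
  0 <= x <= 1 / 2 -> 0 <= y <= 1 / 2 ->
  (turn_cos x < turn_cos y) = (y < x).
Proof.
have pi0 : 0 < pi *+ 2 :> R by rewrite pmulrn_lgt0 ?pi_gt0.
have half_turn (z : R) : 0 <= z <= 1 / 2 -> z * (pi *+ 2) \in `[0, pi :> R].
  move=> /andP[z0 z1]; rewrite in_itv /= mulr_ge0 ?(ltW pi0) //=.
  by have := ler_wpM2r (ltW pi0) z1; rewrite mulr2n; lra.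
move=> hx hy; rewrite /turn_cos ltr_cos ?half_turn //.
by rewrite ltr_pM2r.
Qed.

Lemma turn_cos_eq1 (R : realType) (y : R) :
  0 <= y < 1 -> (turn_cos y == 1) = (y == 0).
Proof.
have low (z : R) : 0 <= z <= 1 / 2 -> (turn_cos z == 1) = (z == 0).
  move=> hz; apply/eqP/eqP => [z1|->]; last exact: turn_cos0.
  have := @turn_cos_decr R z 0 hz ltac:(lra); rewrite turn_cos0 z1 ltxx; lra.
move=> hy; have [y_le|y_gt] := lerP y (1 / 2); first by apply: low; lra.
have -> : turn_cos y = turn_cos (1 - y).
  by rewrite -turn_cosN -(turn_cosDz (- y) 1) addrC.
rewrite low; last lra.
by apply/eqP/eqP; lra.
Qed.

Lemma turn_cos_gt (R : realType) (t y : R) : 0 < t < 1 / 2 -> 0 <= y < 1 ->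
  (turn_cos t < turn_cos y) = (y < t) || (1 - t < y).
Proof.
move=> ht hy; have [y_le|y_gt] := lerP y (1 / 2).
  rewrite turn_cos_decr; lra.
have -> : turn_cos y = turn_cos (1 - y).
  by rewrite -turn_cosN -(turn_cosDz (- y) 1) addrC.
by rewrite turn_cos_decr; lra.
Qed.

(** An integer x satisfies both conditions and weighs 2, because it plays
    both the part of the term just before an integer and that of the term just
    after. *)
Definition return_weight (R : realType) (t x : R) : int :=
  (turn_cos t < turn_cos x)%R%:Z + (turn_cos x == 1)%R%:Z.

(** For a progression of step t that has reached x, [Num.floor x] counts the
    terms that come within t after an integer, or on it, and
    [Num.ceil (x + t)] those that come within t before one, or on it, both
    up to a constant. *)
Definition wrap_count (R : realType) (t x : R) : int :=
  Num.floor x + Num.ceil (x + t).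

(** Since t < 1/2, a term that is not an integer cannot be both within t after
    an integer and within t before one, so that the two increments add up to
    the weight. *)
Lemma wrap_count_step (R : realType) (t x : R) : 0 < t < 1 / 2 ->
  wrap_count t (x + t) - wrap_count t x = return_weight t (x + t).
Proof.
move=> ht; rewrite -[x](addrK t) subrK; move: (x + t) => {}x.
rewrite /wrap_count /return_weight subrK.
set N := Num.floor x; pose y := x - N%:~R.
have xE : x = y + N%:~R by rewrite subrK.
have hy : 0 <= y < 1.
  by have := floor_itv x; rewrite -/N intrD /y; lra.
have Nint : N%:~R \is a @Num.int R by apply: intr_int.
have -> : Num.floor (x - t) = Num.floor (y - t) + N.
  by rewrite xE addrAC floorDrz // intrKfloor.
have -> : Num.ceil (x + t) = Num.ceil (y + t) + N.
  by rewrite xE addrAC ceilDrz // intrKceil.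
have -> : Num.ceil x = Num.ceil y + N.
  by rewrite {1}xE ceilDrz // intrKceil.
rewrite xE turn_cosDz turn_cos_gt // turn_cos_eq1 //.
have fl : Num.floor (y - t) = - (y < t)%R%:Z.
  by apply/floor_def; rewrite intrD mulrNz; case: ltrP => h /=; lra.
have [y0|y0] := eqVneq y 0.
  have -> : Num.ceil y = 0 by rewrite y0 ceil0.
  have -> : Num.ceil (y + t) = 1 by apply/ceil_def; rewrite subrr /=; lra.
  rewrite fl; have -> : y < t by lra.
  by rewrite /=; lra.
have {}y0 : 0 < y by rewrite lt_neqAle eq_sym y0; lra.
have -> : Num.ceil y = 1 by apply/ceil_def; rewrite subrr /=; lra.
have -> : Num.ceil (y + t) = 1 + (1 - t < y)%R%:Z.
  by apply/ceil_def; rewrite rmorphB !intrD; case: (ltrP (1 - t) y) => h /=; lra.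
rewrite fl; case: (ltrP y t) => h1; case: (ltrP (1 - t) y) => h2 /=;
  first [lra | exfalso; lra].
Qed.

Lemma sum_return_weight (R : realType) (t : R) (n : nat) : 0 < t < 1 / 2 ->
  \sum_(k < n) return_weight t (k.+1%:R * t) = wrap_count t (n%:R * t) - 1.
Proof.
move=> ht; elim: n => [|n IHn].
  rewrite big_ord0 mul0r /wrap_count floor0 add0r add0r.
  have -> : Num.ceil t = 1 by apply/ceil_def; rewrite subrr /=; lra.
  by rewrite subrr.
have stepE : n.+1%:R * t = n%:R * t + t by rewrite -natr1 mulrDl mul1r.
by rewrite big_ord_recr /= IHn stepE -wrap_count_step //; lra.
Qed.

Lemma wrap_count_approx (R : realType) (t x : R) :
  2 * x + t - 1 < (wrap_count t x)%:~R < 2 * x + t + 1.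
Proof.
rewrite /wrap_count intrD.
have := floor_itv x; have := ceil_itv (x + t); rewrite !intrD mulrNz /=; lra.
Qed.

(** The sum of the first n weights is 2nt up to a bounded error, so equal
    weights give equal slopes. *)
Lemma turn_determined_by_returns (R : realType) (t s : R) :
  0 < t < 1 / 2 -> 0 < s < 1 / 2 ->
  (forall k, return_weight t (k%:R * t) = return_weight s (k%:R * s)) ->
  t = s.
Proof.
wlog ts : t s / t <= s => [wlg ht hs hw|ht hs hw].
  have [ts|st] := lerP t s; first exact: wlg.
  by apply/esym/wlg; rewrite ?(ltW st).
apply/eqP; rewrite eq_le ts /= -subr_ge0 leNgt; apply/negP => hlt.
have wrapE n : wrap_count t (n%:R * t) = wrap_count s (n%:R * s).
  apply: (addIr (- 1)); rewrite -!sum_return_weight //.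
  by apply: eq_bigr.
pose n := Num.bound (1 / (s - t)).
have hn : 1 < n%:R * (s - t).
  have := @archi_boundP R (1 / (s - t)); rewrite -/n ltr_pdivrMr; last lra.
  by apply; rewrite divr_ge0 //; lra.
have := wrap_count_approx t (n%:R * t); have := wrap_count_approx s (n%:R * s).
rewrite wrapE; nra.
Qed.

(** * Chords of the outer circle *)

(** The scalar product of a and b seen from the origin c; thus [dot_from c a a]
    is the squared distance from c to a. *)
Definition dot_from (R : realType) (c a b : 'rV[R]_2) : R :=
  (a 0 0 - c 0 0) * (b 0 0 - c 0 0) + (a 0 1 - c 0 1) * (b 0 1 - c 0 1).

Lemma row2P (R : realType) (a b : 'rV[R]_2) :
  a 0 0 = b 0 0 -> a 0 1 = b 0 1 -> a = b.
Proof.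
move=> h0 h1; apply/rowP => -[[|[|//]] i_lt].
  by rewrite (_ : Ordinal i_lt = 0) //; apply/val_inj.
by rewrite (_ : Ordinal i_lt = 1) //; apply/val_inj.
Qed.

Lemma dot_from_ge0 (R : realType) (c a : 'rV[R]_2) : 0 <= dot_from c a a.
Proof. by rewrite /dot_from -!expr2 addr_ge0 ?sqr_ge0. Qed.

Lemma dot_from_eq0 (R : realType) (c a : 'rV[R]_2) :
  dot_from c a a = 0 -> a = c.
Proof.
move=> /eqP; rewrite /dot_from -!expr2 paddr_eq0 ?sqr_ge0 // !sqrf_eq0 !subr_eq0.
by move=> /andP[/eqP ? /eqP ?]; apply: row2P.
Qed.

Lemma dot_from_polar (R : realType) (c a b : 'rV[R]_2) :
  dot_from a b b = dot_from c a a + dot_from c b b - 2 * dot_from c a b.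
Proof. rewrite /dot_from; ring. Qed.

(** Stewart's theorem. *)
Lemma dot_from_segment (R : realType) (c a b : 'rV[R]_2) (l : R) :
  let p := l *: a + (1 - l) *: b in
  dot_from c p p = l * dot_from c a a + (1 - l) * dot_from c b b
                   - l * (1 - l) * dot_from a b b.
Proof. rewrite /dot_from !mxE; ring. Qed.

Lemma circleE (R : realType) (c x : 'rV[R]_2) (r : R) : 0 <= r ->
  circle c r x <-> dot_from c x x = r ^+ 2.
Proof.
move=> r0; rewrite /circle /=.
have -> : euclid_norm (x - c) = Num.sqrt (dot_from c x x).
  rewrite /euclid_norm /dot_from -!expr2; congr Num.sqrt.
  rewrite !big_ord_recl big_ord0 addr0 !mxE.
  by congr (_ + (x 0 _ - c 0 _) ^+ 2); apply: val_inj.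
split=> [<-|->]; first by rewrite sqr_sqrtr ?dot_from_ge0.
by rewrite sqrtr_sqr ger0_norm.
Qed.

Lemma segment_chord (R : realType) (c a b : 'rV[R]_2) (r l : R) : 0 <= r ->
  circle c r a -> circle c r b ->
  let p := l *: a + (1 - l) *: b in
  dot_from c p p = r ^+ 2 - 2 * (l * (1 - l)) * (r ^+ 2 - dot_from c a b).
Proof.
move=> r0 /(circleE _ _ r0) ha /(circleE _ _ r0) hb p.
rewrite /p dot_from_segment (dot_from_polar c a b) ha hb; ring.
Qed.

(** The disc is strictly convex: by [dot_from_segment], an interior point of a
    nontrivial segment of the disc is closer to the centre than r. *)
Lemma circle_extreme (R : realType) (c x y z : 'rV[R]_2) (r : R) : 0 <= r ->
  circle c r x -> dot_from c y y <= r ^+ 2 -> dot_from c z z <= r ^+ 2 ->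
  segment y z x -> x = y \/ x = z.
Proof.
move=> r0 /(circleE _ _ r0) hx hy hz [l /= /andP[l0 l1] xE].
have := dot_from_segment c y z l; rewrite /= xE hx => h.
have d0 := dot_from_ge0 y z.
have /eqP : l * (1 - l) * dot_from y z z = 0.
  have := mulr_ge0 (mulr_ge0 l0 (_ : 0 <= 1 - l)) d0; nra.
rewrite !mulf_eq0 => /orP[/orP[/eqP l_eq|/eqP l_eq]|/eqP zy].
- by right; rewrite -xE l_eq scale0r subr0 scale1r add0r.
- by left; rewrite -xE l_eq scale0r addr0 (_ : l = 1) ?scale1r //; lra.
- left; rewrite -xE (dot_from_eq0 zy) -scalerDl.
  by rewrite addrC subrK scale1r.
Qed.

Definition bicircle (R : realType) (c : 'rV[R]_2) (rho rho' : R) :=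
  circle c rho `|` circle c rho'.

Lemma bicircle_bounded (R : realType) (c x : 'rV[R]_2) (rho rho' : R) :
  0 < rho < rho' -> bicircle c rho rho' x -> dot_from c x x <= rho' ^+ 2.
Proof.
by move=> hr [] /circleE ->; rewrite ?lexx ?ler_sqr ?nnegrE //; lra.
Qed.

Lemma bicircle_disjoint (R : realType) (c x : 'rV[R]_2) (rho rho' : R) :
  0 < rho < rho' -> circle c rho x -> ~ circle c rho' x.
Proof. by move=> hr; rewrite /circle /= => -> ?; lra. Qed.

Definition extreme_in (R : realType) (A : set 'rV[R]_2) (x : 'rV[R]_2) :=
  forall y z, A y -> A z -> segment y z x -> x = y \/ x = z.

(** An inner point lies strictly inside the outer diameter through it. *)
Lemma outer_extreme (R : realType) (c x : 'rV[R]_2) (rho rho' : R) :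
  0 < rho < rho' -> bicircle c rho rho' x ->
  circle c rho' x <-> extreme_in (bicircle c rho rho') x.
Proof.
move=> hr Sx; split=> [x_out y z Sy Sz|ext].
  by apply: (circle_extreme _ x_out (bicircle_bounded hr Sy)
    (bicircle_bounded hr Sz)); lra.
case: Sx => // x_in; exfalso.
have rho0 : 0 <= rho by lra.
have rho'0 : 0 <= rho' by lra.
have xE := (circleE _ _ rho0).1 x_in.
(* the outer diameter through x has end points q k and q (- k) *)
pose q (k : R) := c + k *: (x - c).
have q_out k : k ^+ 2 = (rho' / rho) ^+ 2 -> circle c rho' (q k).
  move=> kE; apply/circleE => //.
  have -> : dot_from c (q k) (q k) = k ^+ 2 * dot_from c x x.
    by rewrite /dot_from !mxE; ring.
  by rewrite kE xE -exprMn divfK //; lra.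
pose k := rho' / rho.
have k1 : 1 < k by rewrite ltr_pdivlMr; lra.
have seg : segment (q k) (q (- k)) x.
  exists ((1 + k^-1) / 2) => /=.
    have kV0 : 0 < k^-1 by rewrite invr_gt0; lra.
    have kV1 : k^-1 < 1 by rewrite invf_lt1; lra.
    by lra.
  by apply: row2P; rewrite !mxE; field; lra.
have out1 := q_out k erefl.
have out2 : circle c rho' (q (- k)) by apply: q_out; rewrite sqrrN.
have [xq|xq] := ext _ _ (or_intror out1) (or_intror out2) seg.
  by apply: (bicircle_disjoint hr x_in); rewrite xq.
by apply: (bicircle_disjoint hr x_in); rewrite xq.
Qed.

Definition avoids (R : realType) (c : 'rV[R]_2) (rho : R) (a b : 'rV[R]_2) :=
  forall p, circle c rho p -> ~ segment a b p.

(** Tangency of a chord, in terms that a betweenness isomorphism preserves. *)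
Definition touches (R : realType) (c : 'rV[R]_2) (rho : R) (a b : 'rV[R]_2) :=
  exists! p, circle c rho p /\ segment a b p.

Lemma segment_chord_circle (R : realType) (c a b : 'rV[R]_2) (rho rho' l : R) :
  0 < rho < rho' -> circle c rho' a -> circle c rho' b ->
  circle c rho (l *: a + (1 - l) *: b) <->
  2 * (l * (1 - l)) * (rho' ^+ 2 - dot_from c a b) = rho' ^+ 2 - rho ^+ 2.
Proof.
move=> hr ha hb; rewrite circleE; last lra.
by rewrite (segment_chord l _ ha hb); lra.
Qed.

(** The distance from c to a chord is reached at its midpoint, and its square
    is (rho'^2 + dot_from c a b) / 2. If this is at most rho^2, the chord reaches
    the inner circle, as its end points are outside. *)
Lemma avoidsP (R : realType) (c a b : 'rV[R]_2) (rho rho' : R) :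
  0 < rho < rho' -> circle c rho' a -> circle c rho' b ->
  avoids c rho a b <-> 2 * rho ^+ 2 - rho' ^+ 2 < dot_from c a b.
Proof.
move=> hr ha hb; set D := dot_from c a b.
split=> [av|D_gt p p_in [l /= hl pE]]; last first.
  move: p_in; rewrite -pE => /(segment_chord_circle l hr ha hb).
  rewrite -/D => h; have := sqr_ge0 (2 * l - 1).
  have := dot_from_ge0 a b; rewrite (dot_from_polar c a b).
  move: ha hb => /circleE -> ; last lra.
  move=> /circleE ->; last lra.
  by rewrite -/D; nra.
rewrite ltNge; apply/negP => D_le.
have d0 : 0 < rho' ^+ 2 - rho ^+ 2 by nra.
(* l is the smaller root of l (1 - l) = K *)
pose K := (rho' ^+ 2 - rho ^+ 2) / (2 * (rho' ^+ 2 - D)).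
have K0 : 0 < K by rewrite divr_gt0 //; lra.
have K1 : K <= 1 / 4 by rewrite ler_pdivrMr; lra.
pose s := Num.sqrt (1 - 4 * K).
have sE : s ^+ 2 = 1 - 4 * K by rewrite sqr_sqrtr //; lra.
have s0 : 0 <= s by rewrite sqrtr_ge0.
have s1 : s <= 1 by nra.
pose l := (1 - s) / 2.
apply: (av (l *: a + (1 - l) *: b)); last by exists l => //=; rewrite /l; lra.
apply/(segment_chord_circle l hr ha hb); rewrite -/D.
have -> : l * (1 - l) = K by rewrite /l; nra.
by rewrite /K; field; lra.
Qed.

(** The points of the chord on the inner circle are symmetric about its
    midpoint, so a single one is the midpoint. *)
Lemma touchesP (R : realType) (c a b : 'rV[R]_2) (rho rho' : R) :
  0 < rho < rho' -> circle c rho' a -> circle c rho' b ->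
  touches c rho a b <-> dot_from c a b = 2 * rho ^+ 2 - rho' ^+ 2.
Proof.
move=> hr ha hb; set D := dot_from c a b.
have d0 : 0 < rho' ^+ 2 - rho ^+ 2 by nra.
split=> [[p [[p_in [l /= hl pE]] p_uniq]]|DE].
  move: p_in; rewrite -pE => p_in.
  have hp := (segment_chord_circle l hr ha hb).1 p_in.
  (* the reflection of p in the midpoint of the chord is on the circle too *)
  have /p_uniq qE : circle c rho ((1 - l) *: a + (1 - (1 - l)) *: b) /\
      segment a b ((1 - l) *: a + (1 - (1 - l)) *: b).
    split; last by exists (1 - l) => //=; lra.
    apply/(segment_chord_circle _ hr ha hb); rewrite -hp; ring.
  have /eqP : (2 * l - 1) ^+ 2 * dot_from a b b = 0.
    have := congr1 (fun u => dot_from p u u) qE.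
    rewrite -{2}pE /= /dot_from !mxE -pE !mxE => h; lra.
  rewrite mulf_eq0 sqrf_eq0 => /orP[/eqP l_half|/eqP ba].
    have lE : l = 1 / 2 by lra.
    by move: hp; rewrite lE -/D; lra.
  move: hp; rewrite (_ : dot_from c a b = rho' ^+ 2) ?subrr; first lra.
  rewrite (dot_from_eq0 ba); apply/circleE => //; lra.
exists (2^-1 *: a + (1 - 2^-1) *: b); split.
  split; last by exists 2^-1 => //=; lra.
  by apply/(segment_chord_circle _ hr ha hb); rewrite -/D DE; field.
move=> q [q_in [l /= hl qE]]; move: q_in; rewrite -qE.
move=> /(segment_chord_circle _ hr ha hb); rewrite -/D DE => h.
have /eqP : (2 * l - 1) ^+ 2 * (rho' ^+ 2 - rho ^+ 2) = 0 by lra.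
rewrite mulf_eq0 sqrf_eq0 => /orP[/eqP l_half|/eqP ?]; last by exfalso; lra.
by have -> : l = 2^-1 by lra.
Qed.

(** * Tangent walks *)

(** The condition a (k + 2) <> a k excludes turning back: each outer point is
    on just two tangent chords, so a walk keeps rotating in one direction. *)
Definition tangent_walk (R : realType) (c : 'rV[R]_2) (rho rho' : R)
    (a : nat -> 'rV[R]_2) :=
  [/\ forall k, circle c rho' (a k),
      forall k, touches c rho (a k) (a k.+1) &
      forall k, a k.+2 <> a k].

(** The angle subtended at the centre by a chord tangent to the inner circle:
    half of it has cosine rho / rho'. *)
Definition tangent_angle (R : realType) (rho rho' : R) : R :=
  acos (2 * (rho / rho') ^+ 2 - 1).

Lemma ratio_gt0 (R : realType) (rho rho' : R) :
  0 < rho < rho' -> 0 < rho / rho'.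
Proof. by move=> hr; rewrite divr_gt0; lra. Qed.

Lemma ratio_bounds (R : realType) (rho rho' : R) : 0 < rho < rho' ->
  0 < (rho / rho') ^+ 2 < 1.
Proof.
move=> hr; have q0 := ratio_gt0 hr.
have q1 : rho / rho' < 1 by rewrite ltr_pdivrMr; lra.
by rewrite exprn_gt0 //= expr_lt1 // ltW.
Qed.

Lemma cos_tangent_angle (R : realType) (rho rho' : R) : 0 < rho < rho' ->
  cos (tangent_angle rho rho') = 2 * (rho / rho') ^+ 2 - 1.
Proof.
by move=> /ratio_bounds hq; rewrite acosK // in_itv /=; lra.
Qed.

Lemma tangent_angle_itv (R : realType) (rho rho' : R) : 0 < rho < rho' ->
  0 < tangent_angle rho rho' < pi.
Proof.
by move=> /ratio_bounds hq; rewrite acos_gt0 ?acos_ltpi //; lra.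
Qed.

Lemma radius_cos_tangent_angle (R : realType) (rho rho' : R) :
  0 < rho < rho' ->
  rho' ^+ 2 * cos (tangent_angle rho rho') = 2 * rho ^+ 2 - rho' ^+ 2.
Proof. by move=> hr; rewrite cos_tangent_angle //; field; lra. Qed.

(** Two points u <> w of the circle at the same angle from v are mirror images
    in the line through c and v, so that (u - c) + (w - c) = 2 g (v - c). *)
Lemma tangent_reflection (R : realType) (c u v w : 'rV[R]_2) (r g : R) :
  0 < r -> circle c r u -> circle c r v -> circle c r w ->
  dot_from c u v = r ^+ 2 * g -> dot_from c v w = r ^+ 2 * g -> w <> u ->
  forall x, dot_from c x w = 2 * g * dot_from c x v - dot_from c x u.
Proof.
move=> r0 /circleE hu /circleE hv /circleE hw huv hvw wu x.
move: (hu (ltW r0)) (hv (ltW r0)) (hw (ltW r0)) => {}hu {}hv {}hw.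
have r2 : r ^+ 2 != 0 by rewrite expf_neq0 // gt_eqF.
(* With origin c, e = u + w - 2 g v is orthogonal to the nonzero vectors v and
   n = w - u, which are orthogonal to each other; in the plane, e = 0. *)
pose v0 := v 0 0 - c 0 0; pose v1 := v 0 1 - c 0 1.
pose n0 := w 0 0 - u 0 0; pose n1 := w 0 1 - u 0 1.
pose e0 := w 0 0 - c 0 0 + (u 0 0 - c 0 0) - 2 * g * v0.
pose e1 := w 0 1 - c 0 1 + (u 0 1 - c 0 1) - 2 * g * v1.
have vE : v0 ^+ 2 + v1 ^+ 2 = r ^+ 2 by rewrite !expr2.
have vn : v0 * n0 + v1 * n1 = 0.
  have -> : v0 * n0 + v1 * n1 = dot_from c v w - dot_from c u v.
    by rewrite /dot_from /v0 /v1 /n0 /n1; ring.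
  by rewrite huv hvw subrr.
have en : e0 * n0 + e1 * n1 = 0.
  have -> : e0 * n0 + e1 * n1 = dot_from c w w - dot_from c u u
                                - 2 * g * (v0 * n0 + v1 * n1).
    by rewrite /dot_from /e0 /e1 /n0 /n1; ring.
  by rewrite vn hw hu subrr mulr0 subrr.
have ev : e0 * v0 + e1 * v1 = 0.
  have -> : e0 * v0 + e1 * v1 = dot_from c v w + dot_from c u v
                                - 2 * g * (v0 ^+ 2 + v1 ^+ 2).
    by rewrite /dot_from /e0 /e1 /v0 /v1; ring.
  by rewrite huv hvw vE; ring.
have cross0 : e0 * n1 - e1 * n0 = 0.
  apply/(mulfI r2); rewrite mulr0 -vE.
  have -> : (v0 ^+ 2 + v1 ^+ 2) * (e0 * n1 - e1 * n0) =
    (e0 * v0 + e1 * v1) * (v0 * n1 - v1 * n0)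
    + (e0 * v1 - e1 * v0) * (v0 * n0 + v1 * n1) by ring.
  by rewrite ev vn mul0r mulr0 addr0.
have n_neq0 : n0 ^+ 2 + n1 ^+ 2 != 0.
  by apply/eqP; rewrite !expr2 => /dot_from_eq0.
have /eqP : e0 ^+ 2 + e1 ^+ 2 = 0.
  apply/(mulfI n_neq0); rewrite mulr0.
  have -> : (n0 ^+ 2 + n1 ^+ 2) * (e0 ^+ 2 + e1 ^+ 2) =
    (e0 * n0 + e1 * n1) ^+ 2 + (e0 * n1 - e1 * n0) ^+ 2 by ring.
  by rewrite en cross0 expr0n addr0.
rewrite paddr_eq0 ?sqr_ge0 // !sqrf_eq0 => /andP[/eqP e00 /eqP e10].
rewrite /dot_from.
have -> : w 0 0 - c 0 0 = 2 * g * v0 - (u 0 0 - c 0 0).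
  by move: e00; rewrite /e0; lra.
have -> : w 0 1 - c 0 1 = 2 * g * v1 - (u 0 1 - c 0 1).
  by move: e10; rewrite /e1; lra.
by rewrite /v0 /v1; ring.
Qed.

(** By [tangent_reflection], the scalar products with a 0 satisfy the recurrence
    of k |-> cos (k alpha), whichever the direction of rotation. *)
Lemma tangent_walk_dot (R : realType) (c : 'rV[R]_2) (rho rho' : R)
    (a : nat -> 'rV[R]_2) (k : nat) :
  0 < rho < rho' -> tangent_walk c rho rho' a ->
  dot_from c (a 0%N) (a k)
    = rho' ^+ 2 * cos (k%:R * tangent_angle rho rho').
Proof.
move=> hr [a_out a_tan a_turn]; set al := tangent_angle rho rho'.
have step j : dot_from c (a j) (a j.+1) = rho' ^+ 2 * cos al.
  rewrite radius_cos_tangent_angle //; exact/(touchesP hr).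
suff [] : dot_from c (a 0%N) (a k) = rho' ^+ 2 * cos (k%:R * al) /\
  dot_from c (a 0%N) (a k.+1) = rho' ^+ 2 * cos (k.+1%:R * al) by [].
elim: k => [|k [IHk IHk1]].
  rewrite mul0r cos0 mulr1 mul1r step; split=> //.
  by apply/(circleE c (a 0%N)) => //; lra.
split=> //.
have rho'0 : 0 < rho' by lra.
rewrite (tangent_reflection rho'0 (a_out k) (a_out k.+1) (a_out k.+2)
  (step k) (step k.+1) (a_turn k)) IHk IHk1.
have -> : k.+2%:R * al = k.+1%:R * al + al by rewrite -natr1 mulrDl mul1r.
have -> : k%:R * al = k.+1%:R * al - al.
  by rewrite -[k.+1%:R]natr1 mulrDl mul1r addrK.
by rewrite cosB (cosD _ al); ring.
Qed.

Lemma tangent_walk_exists (R : realType) (c : 'rV[R]_2) (rho rho' : R) :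
  0 < rho < rho' -> exists a, tangent_walk c rho rho' a.
Proof.
move=> hr; set al := tangent_angle rho rho'.
pose pt (x : R) : 'rV[R]_2 :=
  c + rho' *: \row_(i < 2) (if i == 0 then cos x else sin x).
have pt_dot x y : dot_from c (pt x) (pt y) = rho' ^+ 2 * cos (y - x).
  by rewrite /dot_from !mxE /= cosB; ring.
have pt_out x : circle c rho' (pt x).
  by apply/circleE; [lra | rewrite pt_dot subrr cos0 mulr1].
have kS k : k.+1%:R * al = k%:R * al + al by rewrite -natr1 mulrDl mul1r.
exists (fun k => pt (k%:R * al)); split=> k //.
  apply/(touchesP hr) => //.
  by rewrite pt_dot kS addrAC subrr add0r radius_cos_tangent_angle.
move=> pt_eq; have := pt_dot (k%:R * al) (k.+2%:R * al).
rewrite pt_eq pt_dot subrr cos0 mulr1 !kS.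
have -> : k%:R * al + al + al - k%:R * al = al *+ 2 by rewrite mulr2n; ring.
rewrite cos_mulr2n cos2sin2.
have := sin_gt0_pi (tangent_angle_itv hr); rewrite -/al => s0 h.
have /eqP : rho' ^+ 2 * sin al ^+ 2 = 0 by lra.
rewrite mulf_eq0 !sqrf_eq0; lra.
Qed.

Lemma walk_avoids (R : realType) (c : 'rV[R]_2) (rho rho' : R)
    (a : nat -> 'rV[R]_2) (k : nat) :
  0 < rho < rho' -> tangent_walk c rho rho' a ->
  let al := tangent_angle rho rho' in
  avoids c rho (a 0%N) (a k) <-> cos al < cos (k%:R * al).
Proof.
move=> hr walk al; have [a_out _ _] := walk.
have r2 : 0 < rho' ^+ 2 by rewrite exprn_gt0; lra.
rewrite (avoidsP hr (a_out 0%N) (a_out k)) (tangent_walk_dot k hr walk).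
by rewrite -radius_cos_tangent_angle // ltr_pM2l.
Qed.

Lemma walk_returns (R : realType) (c : 'rV[R]_2) (rho rho' : R)
    (a : nat -> 'rV[R]_2) (k : nat) :
  0 < rho < rho' -> tangent_walk c rho rho' a ->
  a k = a 0%N <-> cos (k%:R * tangent_angle rho rho') = 1.
Proof.
move=> hr walk; have [a_out _ _] := walk.
have dotE := tangent_walk_dot k hr walk.
have r2 : rho' ^+ 2 != 0 by rewrite expf_neq0 // gt_eqF //; lra.
have rho'0 : 0 <= rho' by lra.
have h0 := (circleE _ _ rho'0).1 (a_out 0%N).
have hk := (circleE _ _ rho'0).1 (a_out k).
split=> [akE|cos1].
  by apply/(mulfI r2); rewrite -dotE akE h0 mulr1.
by apply/dot_from_eq0; rewrite (dot_from_polar c) dotE cos1 h0 hk; ring.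
Qed.

(** * Isomorphisms carry tangent walks to tangent walks *)

Section Isomorphism.
Variables (R : realType) (c d : 'rV[R]_2) (rho rho' tau tau' : R).
Variable f : 'rV[R]_2 -> 'rV[R]_2.
Hypotheses (hr : 0 < rho < rho') (ht : 0 < tau < tau').
Let S := bicircle c rho rho'.
Let T := bicircle d tau tau'.
Hypothesis f_iso : betweenness_isomorphism S T f.

Lemma iso_extreme x : S x -> extreme_in S x <-> extreme_in T (f x).
Proof.
move: f_iso => [[f_fun f_inj f_surj] f_btw] Sx; split=> ext y z.
  move=> /f_surj[y0 Sy0 <-] /f_surj[z0 Sz0 <-] /(f_btw _ _ _ Sx Sy0 Sz0).
  by move=> /(ext _ _ Sy0 Sz0)[->|->]; [left|right].
move=> Sy Sz /(f_btw _ _ _ Sx Sy Sz) /(ext _ _ (f_fun _ Sy) (f_fun _ Sz)).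
by case=> /f_inj E; [left|right]; apply: E; rewrite inE.
Qed.

Lemma iso_outer x : S x -> circle c rho' x <-> circle d tau' (f x).
Proof.
move=> Sx; have Tfx : T (f x) by move: f_iso => [[f_fun _ _] _]; apply: f_fun.
by rewrite (outer_extreme hr Sx) (outer_extreme ht Tfx) iso_extreme.
Qed.

Lemma iso_inner x : S x -> circle c rho x <-> circle d tau (f x).
Proof.
move=> Sx; have Tfx : T (f x) by move: f_iso => [[f_fun _ _] _]; apply: f_fun.
have := iso_outer Sx; have := @bicircle_disjoint _ c x _ _ hr.
have := @bicircle_disjoint _ d (f x) _ _ ht.
by move: Sx Tfx; rewrite /S /T /bicircle /setU /=; tauto.
Qed.

Lemma iso_inner_chord a b p : circle c rho' a -> circle c rho' b -> S p ->
  (circle c rho p /\ segment a b p) <->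
  (circle d tau (f p) /\ segment (f a) (f b) (f p)).
Proof.
move=> ha hb Sp; have [_ f_btw] := f_iso.
by rewrite (iso_inner Sp) (f_btw p a b Sp (or_intror ha) (or_intror hb)).
Qed.

Lemma iso_avoids a b : circle c rho' a -> circle c rho' b ->
  avoids c rho a b <-> avoids d tau (f a) (f b).
Proof.
move=> ha hb; have [[_ _ f_surj] _] := f_iso; split=> av.
  move=> q q_in seg; have [p Sp pE] := f_surj q (or_introl q_in); subst q.
  by have [p_in pseg] := (iso_inner_chord ha hb Sp).2 (conj q_in seg);
     apply: (av p).
move=> p p_in seg; have Sp : S p by left.
have [q_in qseg] := (iso_inner_chord ha hb Sp).1 (conj p_in seg).
exact: (av (f p)).
Qed.

Lemma iso_touches a b : circle c rho' a -> circle c rho' b ->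
  touches c rho a b -> touches d tau (f a) (f b).
Proof.
move=> ha hb [p [p_on p_uniq]]; have [[_ _ f_surj] _] := f_iso.
have Sp : S p by left; case: p_on.
exists (f p); split=> [|q q_on]; first exact/(iso_inner_chord ha hb Sp).
have [p' Sp' pE] := f_surj q (or_introl q_on.1); subst q.
by rewrite (p_uniq p') //; apply/(iso_inner_chord ha hb Sp').
Qed.

Lemma iso_tangent_walk a :
  tangent_walk c rho rho' a -> tangent_walk d tau tau' (f \o a).
Proof.
move=> [a_out a_tan a_turn]; have [[_ f_inj _] _] := f_iso.
have Sa k : S (a k) by right.
split=> k /=.
- exact/(iso_outer (Sa k)).
- exact: iso_touches.
- by move=> /f_inj E; apply: (a_turn k); apply: E; rewrite inE.
Qed.

Lemma iso_ratio : rho / rho' = tau / tau'.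
Proof.
have [a a_walk] := tangent_walk_exists c hr.
have b_walk := iso_tangent_walk a_walk.
have [[_ f_inj _] _] := f_iso.
have [a_out _ _] := a_walk.
have Sa k : S (a k) by right.
set al := tangent_angle rho rho'; set be := tangent_angle tau tau'.
have cos_gt k : (cos al < cos (k%:R * al)) = (cos be < cos (k%:R * be)).
  apply/idP/idP.
    move=> /(walk_avoids k hr a_walk).
    move=> /(iso_avoids (a_out 0%N) (a_out k)).
    by move=> /(walk_avoids k ht b_walk).
  move=> /(walk_avoids k ht b_walk).
  move=> /(iso_avoids (a_out 0%N) (a_out k)).
  by move=> /(walk_avoids k hr a_walk).
have cos_1 k : (cos (k%:R * al) == 1) = (cos (k%:R * be) == 1).
  apply/eqP/eqP.
    move=> /(walk_returns k hr a_walk) E.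
    by apply/(walk_returns k ht b_walk); rewrite /= E.
  move=> /(walk_returns k ht b_walk) /f_inj E.
  by apply/(walk_returns k hr a_walk); apply: E; rewrite inE.
have pi2 : 0 < pi *+ 2 :> R by rewrite pmulrn_lgt0 ?pi_gt0.
have turn (x : R) k : turn_cos (k%:R * (x / (pi *+ 2))) = cos (k%:R * x).
  by rewrite /turn_cos -mulrA divfK // gt_eqF.
have turn_itv (x : R) : 0 < x < pi -> 0 < x / (pi *+ 2) < 1 / 2.
  move=> hx; apply/andP; split; first by rewrite divr_gt0 //; lra.
  by rewrite ltr_pdivrMr // (mulr2n pi); lra.
have al_be : al / (pi *+ 2) = be / (pi *+ 2).
  apply: turn_determined_by_returns => [||k].
  - exact/turn_itv/tangent_angle_itv.
  - exact/turn_itv/tangent_angle_itv.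
  have := turn al 1%N; have := turn be 1%N; rewrite !mul1r => be1 al1.
  by rewrite /return_weight !turn be1 al1 cos_gt cos_1.
have /(congr1 cos) : al = be.
  by apply: (mulIf _ al_be); rewrite invr_eq0 gt_eqF.
rewrite !cos_tangent_angle // => sqE.
have /eqP : (rho / rho') ^+ 2 = (tau / tau') ^+ 2 by lra.
by rewrite eqrXn2 ?ltW ?ratio_gt0 // => /eqP.
Qed.

End Isomorphism.

(** * Homotheties *)

Definition homothety (R : realType) (c d : 'rV[R]_2) (s : R) (x : 'rV[R]_2) :=
  d + s *: (x - c).

Lemma homothetyK (R : realType) (c d : 'rV[R]_2) (s : R) : s != 0 ->
  cancel (homothety c d s) (homothety d c s^-1).
Proof.
move=> s0 x; rewrite /homothety addrAC subrr add0r scalerA mulVf //.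
by rewrite scale1r addrC subrK.
Qed.

Lemma homothety_segment (R : realType) (c d : 'rV[R]_2) (s : R)
    (x y z : 'rV[R]_2) :
  segment y z x ->
  segment (homothety c d s y) (homothety c d s z) (homothety c d s x).
Proof.
move=> [l hl <-]; exists l => //.
by apply: row2P; rewrite !mxE; ring.
Qed.

Lemma homothety_circle (R : realType) (c d x : 'rV[R]_2) (s r : R) :
  0 < s -> 0 <= r -> circle c r x -> circle d (s * r) (homothety c d s x).
Proof.
move=> s0 r0 /(circleE _ _ r0) xE; apply/circleE.
  by rewrite mulr_ge0 // ltW.
by rewrite exprMn -xE /dot_from !mxE; ring.
Qed.

Lemma homothety_iso (R : realType) (c d : 'rV[R]_2) (s rho rho' : R) :
  0 < s -> 0 <= rho -> 0 <= rho' ->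
  betweenness_isomorphism (bicircle c rho rho')
    (bicircle d (s * rho) (s * rho')) (homothety c d s).
Proof.
move=> s0 r0 r0'.
have sV0 : 0 < s^-1 by rewrite invr_gt0.
have s_neq0 : s != 0 by rewrite gt_eqF.
have fK := homothetyK c d s_neq0.
have gK : cancel (homothety d c s^-1) (homothety c d s).
  by have := @homothetyK _ d c s^-1; rewrite invrK invr_eq0; apply.
split; first split.
- by move=> x [] x_on; [left|right]; apply: homothety_circle.
- by move=> x y _ _ /(can_inj fK).
- move=> y y_on; exists (homothety d c s^-1 y); last exact: gK.
  have back r : 0 <= r -> circle d (s * r) y ->
      circle c r (homothety d c s^-1 y).
    move=> hr /(homothety_circle c sV0); rewrite mulKf //; apply.
    by rewrite mulr_ge0 // ltW.
  by case: y_on => ?; [left|right]; apply: back.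
move=> x y z _ _ _; split; last exact: homothety_segment.
by move=> /(homothety_segment d c s^-1); rewrite !fK.
Qed.

Theorem corollary3p3 (R : realType) (c d : 'rV[R]_2) (rho rho' tau tau' : R)
    (hrho : 0 < rho) (hrho' : rho < rho') (htau : 0 < tau) (htau' : tau < tau') :
  betweenness_isomorphic (circle c rho `|` circle c rho')
                         (circle d tau `|` circle d tau')
  <-> rho / rho' = tau / tau'.
Proof.
split=> [[f f_iso]|ratioE].
  by apply: (iso_ratio _ _ f_iso); lra.
exists (homothety c d (tau' / rho')).
have tau'E : tau' / rho' * rho' = tau' by rewrite divfK //; lra.
have tauE : tau' / rho' * rho = tau.
  by rewrite mulrAC -mulrA ratioE mulrC divfK //; lra.
rewrite -[in circle d tau]tauE -{2}tau'E.
by apply: homothety_iso; rewrite ?divr_gt0 //; lra.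
Qed.
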